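(* Let $D=(b_1,\dots,b_N)$ be a general Dyck path, let $R^{(0)}$ be its canonical rank sequence, and let $\widetilde R$ be the rank sequence of the increasing balanced path diagram output by Algorithm VIB started from $T(D,R^{(0)})$. If $R$ is any weakly increasing sequence with $R^{(0)}\preceq R\preceq\widetilde R$, then Algorithm VIB started from $T(D,R)$ outputs the rank sequence $\widetilde R$.
   Context: A path diagram $T(D,R)$, $R=(r_1,\dots,r_N)$, consists of arrows $A_i=(1,b_i)$ starting at $(i,r_i)$ with end rank $r_i+b_i$. Red arrow: $b_i>0$, segment in row $j$ (strip between heights $j,j+1$) iff $r_i\le j\le r_i+b_i-1$; blue: $b_i<0$, segment in row $j$ iff $r_i+b_i\le j\le r_i-1$. Row count $c(j)$ = #red minus #blue segments in row $j$; balanced: all $c(j)=0$. A general Dyck path has sum $0$ and nonnegative partial sums $b_1+\dots+b_{i-1}$. The canonical (minimal) rank sequence $R^{(0)}$ of $D$ is given by $r_1=\max\{0,-b_1\}$ and $r_{i+1}=\max\{r_i,-b_{i+1}\}$. For rank sequences, $R\preceq R'$ means $r_i\le r_i'$ for all $i$. Algorithm VIB on $T(D,R)$ with $R$ weakly increasing: repeat: if all row counts are $\le0$, stop and output the current rank sequence; otherwise find the lowest row $j$ with $c(j)>0$, find the rightmost arrow starting at level $j$, say $A_i$, and increase $r_i$ by $1$. *)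

(* Defs.v *)
From mathcomp Require Export all_boot all_order all_algebra.

Set Implicit Arguments.
Unset Strict Implicit.
Unset Printing Implicit Defensive.

Import Order.TTheory GRing.Theory Num.Theory.
Local Open Scope ring_scope.

(* A path D = (b_1, ..., b_N) and a rank sequence R = (r_1, ..., r_N) are
   N-tuples of integers; b_i and r_i are [tnth D i] and [tnth R i], with the
   indices i shifted to start at 0. *)

Definition general_dyck (N : nat) (D : N.-tuple int) : Prop :=
  \sum_(k < N) tnth D k = 0 /\
  forall i : 'I_N, 0 <= \sum_(k < N | (k < i)%N) tnth D k.

(* scanl starts from the accumulator 0, so the first entry is max(0, -b_1) and
   each next one is max(r_i, -b_{i+1}). *)
Definition canonical_rank (N : nat) (D : N.-tuple int) : N.-tuple int :=
  [tuple of scanl (fun r b : int => Num.max r (- b)) 0 D].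

Definition weakly_increasing (N : nat) (R : N.-tuple int) : Prop :=
  forall i k : 'I_N, (i <= k)%N -> tnth R i <= tnth R k.

Definition rank_le (N : nat) (R R' : N.-tuple int) : Prop :=
  forall i : 'I_N, tnth R i <= tnth R' i.

Definition red_segment (N : nat) (D R : N.-tuple int) (j : int) (i : 'I_N) :=
  (0 < tnth D i) && (tnth R i <= j <= tnth R i + tnth D i - 1).

Definition blue_segment (N : nat) (D R : N.-tuple int) (j : int) (i : 'I_N) :=
  (tnth D i < 0) && (tnth R i + tnth D i <= j <= tnth R i - 1).

Definition row_count (N : nat) (D R : N.-tuple int) (j : int) : int :=
  #|[set i | red_segment D R j i]|%:Z - #|[set i | blue_segment D R j i]|%:Z.

Definition lowest_positive_row (N : nat) (D R : N.-tuple int) (j : int) : Prop :=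
  0 < row_count D R j /\ forall j' : int, j' < j -> row_count D R j' <= 0.

Definition rightmost_at_level (N : nat) (R : N.-tuple int) (j : int)
    (i : 'I_N) : Prop :=
  tnth R i = j /\ forall k : 'I_N, tnth R k = j -> (k <= i)%N.

Definition raise_rank (N : nat) (R : N.-tuple int) (i : 'I_N) : N.-tuple int :=
  [tuple if k == i then tnth R k + 1 else tnth R k | k < N].

(* [VIB_output D R R'] : the (deterministic) algorithm started from T(D, R)
   terminates and outputs R'. *)
Inductive VIB_output (N : nat) (D : N.-tuple int) :
    N.-tuple int -> N.-tuple int -> Prop :=
| VIB_stop (R : N.-tuple int) :
    (forall j : int, row_count D R j <= 0) -> VIB_output D R R
| VIB_step (R R' : N.-tuple int) (j : int) (i : 'I_N) :
    lowest_positive_row D R j -> rightmost_at_level R j i ->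
    VIB_output D (raise_rank R i) R' -> VIB_output D R R'.

(* Main.v *)
Require Import Defs.
From mathcomp Require Import zify.

Set Implicit Arguments.
Unset Strict Implicit.
Unset Printing Implicit Defensive.

Import Order.TTheory GRing.Theory Num.Theory.
Local Open Scope ring_scope.

(** If [S] lies below a weakly increasing [R] all of whose row counts are
    nonpositive, then a VIB step on [S] stays below [R]: were the raised arrow
    [i], starting in the positive row [j], already at its height in [R], the
    arrows up to [i] would start at level at most [j] and the later ones above
    [j], both in [S] and in [R]; passing from [S] to [R] could then only add red
    and remove blue segments in row [j], so that row would be positive in [R].
    Hence VIB started below [R] stops below [R].  Applied with [R := Rt] this
    gives an output [T] below [Rt]; applied with [R := T] to the run from the
    canonical ranks it gives [Rt] below [T]. *)

(** Both the diagram and the row may vary: it serves to compare two rows of one diagram and one row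
    in two diagrams. *)
Lemma row_count_le (N : nat) (D S R : N.-tuple int) (j j' : int) :
  (forall k, red_segment D S j k -> red_segment D R j' k) ->
  (forall k, blue_segment D R j' k -> blue_segment D S j k) ->
  row_count D S j <= row_count D R j'.
Proof.
move=> hred hblue; apply: lerB; rewrite lez_nat; apply/subset_leq_card.
  by apply/subsetP => k; rewrite !inE; apply: hred.
by apply/subsetP => k; rewrite !inE; apply: hblue.
Qed.

(* The highest starting level [tnth R k <= j] works: no arrow starts in between,
   so going down from row [j] to it loses no red and gains no blue segment. *)
Lemma positive_row_start_below (N : nat) (D R : N.-tuple int) (j : int) :
  0 < row_count D R j ->
  exists2 k, tnth R k <= j & 0 < row_count D R (tnth R k).
Proof.
move=> cj_gt0.
(* A positive row has a red segment, whose arrow starts at or below [j]; so the maximum taken next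
   ranges over a nonempty set. *)
have [k0 /andP[_ /andP[k0_le _]]] : exists k, red_segment D R j k.
  apply/existsP; apply: contraLR cj_gt0; rewrite negb_exists => /forallP nored.
  rewrite -leNgt /row_count (_ : [set i | _] = set0) ?cards0 ?sub0r ?oppr_le0 //.
  by apply/setP => i; rewrite !inE; apply/negbTE/nored.
case: (@Order.TotalTheory.arg_maxP _ _ _ k0 (fun k => tnth R k <= j) (tnth R) k0_le)
  => k k_le k_max.
exists k => //; apply: lt_le_trans cj_gt0 _; apply: row_count_le => l.
  rewrite /red_segment => /andP[-> /andP[h1 h2]].
  by have := k_max l h1; lia.
rewrite /blue_segment => /andP[-> /andP[h1 h2]].
by case: (leP (tnth R l) j) => [/k_max|]; lia.
Qed.

(** Rows range over all integers, but below any positive row some starting level is positive, so the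
    lowest positive row is a minimum over finitely many levels and has an arrow starting in it. *)
Lemma VIB_step_exists (N : nat) (D R : N.-tuple int) :
  (forall j, row_count D R j <= 0) \/
  exists j i, lowest_positive_row D R j /\ rightmost_at_level R j i.
Proof.
case: (pickP (fun k => 0 < row_count D R (tnth R k))) => [k0 k0_pos|nopos].
  right.
  case: (@Order.TotalTheory.arg_minP _ _ _ k0
           (fun k => 0 < row_count D R (tnth R k)) (tnth R) k0_pos) => k k_pos k_min.
  case: (@arg_maxnP _ k (fun l => tnth R l == tnth R k) (@nat_of_ord N) (eqxx _))
    => i /eqP i_eq i_max.
  exists (tnth R k), i; split; split => //.
    move=> j' j'_lt; rewrite leNgt; apply/negP.
    by case/positive_row_start_below => l l_le /k_min; lia.
  by move=> l /eqP /i_max.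
left=> j; rewrite leNgt; apply/negP => /positive_row_start_below[k _].
by rewrite nopos.
Qed.

Lemma tnth_raise_rank (N : nat) (R : N.-tuple int) (i k : 'I_N) :
  tnth (raise_rank R i) k = if k == i then tnth R k + 1 else tnth R k.
Proof. by rewrite tnth_mktuple. Qed.

Lemma rightmost_at_level_gt (N : nat) (R : N.-tuple int) (j : int) (i k : 'I_N) :
  weakly_increasing R -> rightmost_at_level R j i -> (i < k)%N -> j < tnth R k.
Proof.
move=> Rinc [Ri Rmax] ik; rewrite lt_neqAle -{2}Ri Rinc ?(ltnW ik) // andbT.
by apply/eqP => /esym /Rmax; rewrite leqNgt ik.
Qed.

Lemma weakly_increasing_raise (N : nat) (R : N.-tuple int) (j : int) (i : 'I_N) :
  weakly_increasing R -> rightmost_at_level R j i ->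
  weakly_increasing (raise_rank R i).
Proof.
move=> Rinc Ri k l kl; rewrite !tnth_raise_rank.
have kl_le := Rinc _ _ kl.
case: (eqVneq k i) => [ki|_]; case: (eqVneq l i) => [li|li]; try lia.
have : (i < l)%N.
  by rewrite ltn_neqAle -{2}ki kl andbT; apply: contra li => /eqP/val_inj ->.
by move/(rightmost_at_level_gt Rinc Ri); rewrite ki (proj1 Ri); lia.
Qed.

Lemma VIB_step_rank_le (N : nat) (D S R : N.-tuple int) (j : int) (i : 'I_N) :
  weakly_increasing S -> weakly_increasing R -> rank_le S R ->
  (forall j, row_count D R j <= 0) ->
  0 < row_count D S j -> rightmost_at_level S j i ->
  rank_le (raise_rank S i) R.
Proof.
move=> Sinc Rinc SR Rbal Sj Si k; rewrite tnth_raise_rank.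
case: eqVneq => [{k}->|_]; last exact: SR.
rewrite lezD1 lt_neqAle SR andbT; apply/eqP => SRi.
have Sij := proj1 Si.
suff : 0 < row_count D R j by rewrite ltNge Rbal.
apply: lt_le_trans Sj _; apply: row_count_le => k.
  rewrite /red_segment => /andP[-> /andP[h1 h2]].
  have := SR k; case: (leqP k i) => [/Rinc|/(rightmost_at_level_gt Sinc Si)]; lia.
(* An arrow blue in row [j] of [R] starts above [j], hence lies right of [i], so it starts above [j]
   in [S] too; its end is no higher in [S]. *)
rewrite /blue_segment => /andP[-> /andP[h1 h2]].
by have := SR k; case: (leqP k i) => [/Rinc|/(rightmost_at_level_gt Sinc Si)]; lia.
Qed.

Lemma VIB_output_spec (N : nat) (D R T : N.-tuple int) :
  VIB_output D R T -> weakly_increasing R ->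
  weakly_increasing T /\ forall j, row_count D T j <= 0.
Proof.
elim=> [//|{}R {}T j i _ Ri _ IH Rinc].
exact/IH/(weakly_increasing_raise Rinc Ri).
Qed.

(** With [VIB_output_spec] and [VIB_output_ge], this makes [T] the least weakly increasing sequence
    above [S] without positive rows. *)
Lemma VIB_output_rank_le (N : nat) (D S T R : N.-tuple int) :
  VIB_output D S T -> weakly_increasing S -> weakly_increasing R ->
  (forall j, row_count D R j <= 0) -> rank_le S R -> rank_le T R.
Proof.
move=> ST Sinc Rinc Rbal; elim: ST Sinc => [//|{}S {}T j i [Sj _] Si _ IH Sinc SR].
apply: IH; first exact: weakly_increasing_raise Sinc Si.
exact: VIB_step_rank_le Sinc Rinc SR Rbal Sj Si.
Qed.

Lemma VIB_output_ge (N : nat) (D S T : N.-tuple int) :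
  VIB_output D S T -> rank_le S T.
Proof.
elim=> [{}S _ i|{}S {}T j i _ _ _ IH k]; first exact: lexx.
by have := IH k; rewrite tnth_raise_rank; case: ifP => _; lia.
Qed.

Lemma VIB_terminates_below (N : nat) (D S R : N.-tuple int) :
  weakly_increasing S -> weakly_increasing R ->
  (forall j, row_count D R j <= 0) -> rank_le S R ->
  exists T, VIB_output D S T.
Proof.
move=> Sinc Rinc Rbal.
(* The total gap to the bound [R] is the termination measure. *)
have [n] := ubnP (\sum_k `|tnth R k - tnth S k|)%N.
elim: n => // n IH in S Sinc *; rewrite ltnS => le_n SR.
have [Sbal|[j [i [[Sj Slow] Si]]]] := VIB_step_exists D S.
  by exists S; apply: VIB_stop.
have SR' := VIB_step_rank_le Sinc Rinc SR Rbal Sj Si.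
have [||//|T hT] := IH (raise_rank S i).
- exact: weakly_increasing_raise Sinc Si.
- apply: leq_trans le_n; rewrite (bigD1 i) //= [ltnRHS](bigD1 i) //=.
  rewrite -addSn; apply: leq_add.
    (* The absolute gap at [i] shrinks because the raised rank is still at most that of [R]. *)
    by have := SR' i; rewrite tnth_raise_rank eqxx; lia.
  by apply: leq_sum => k /negbTE ki; rewrite tnth_raise_rank ki.
by exists T; apply: VIB_step Si hT.
Qed.

Lemma canonical_rank_increasing (N : nat) (D : N.-tuple int) :
  weakly_increasing (canonical_rank D).
Proof.
have path_scanl (s : seq int) x :
    path <=%R x (scanl (fun r b : int => Num.max r (- b)) x s).
  by elim: s x => //= b s IH x; rewrite IH le_max lexx.
move=> i k ik; rewrite !(tnth_nth 0).
by apply: (sorted_leq_nth le_trans lexx) => //;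
  rewrite ?inE ?size_tuple //; apply: path_sorted (path_scanl _ 0).
Qed.

Theorem theorem2 (N : nat) (D : N.-tuple int) (Rt : N.-tuple int)
    (hD : general_dyck D)
    (hRt : VIB_output D (canonical_rank D) Rt)
    (R : N.-tuple int)
    (hR : weakly_increasing R)
    (hlow : rank_le (canonical_rank D) R)
    (hhigh : rank_le R Rt) :
  VIB_output D R Rt.
Proof.
have R0inc := canonical_rank_increasing D.
have [Rtinc Rtbal] := VIB_output_spec hRt R0inc.
have [T hT] := VIB_terminates_below hR Rtinc Rtbal hhigh.
have [Tinc Tbal] := VIB_output_spec hT hR.
have TRt := VIB_output_rank_le hT hR Rtinc Rtbal hhigh.
have RtT : rank_le Rt T.
  apply: (VIB_output_rank_le hRt R0inc Tinc Tbal) => i.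
  exact: le_trans (hlow i) (VIB_output_ge hT i).
suff <- : T = Rt by [].
by apply: eq_from_tnth => i; apply/le_anti; rewrite TRt RtT.
Qed.
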